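(* Let $h$ be a dilation on $\mathbb{R}^n$ with signature of positive integers $r_1\le r_2\le\dots\le r_n$ such that $\ell=r_n-2r_{n-1}\ge 0$. Let $A=(a_i^j)_{i,j=1}^{n-1}$ be a symmetric matrix of real numbers such that $a_i^j\neq 0$ only for $r_i=r_j=r_{n-1}$. Then there is a unique derivation of weight $\ell$ of the Lie algebra $\mathfrak{m}=\mathfrak{g}_{<0}(h)$, $$D_\ell^A\in\bigoplus_{p<0}\mathfrak{g}_{p+\ell}(h)\otimes\mathfrak{g}_p(h)^*,$$ which vanishes on the constant vector fields $\partial_{x^1},\dots,\partial_{x^n}$ and which on the linear vector fields $x^i\partial_{x^j}\in\mathfrak{m}$ (that is, those with $r_i<r_j$) reads $$D_\ell^A(x^i\partial_{x^j})=\delta_j^n\sum_{k=1}^{n-1}a_i^k\,\partial_{x^k}.$$ As vanishing on constant vector fields and being of weight $\ell\ge 0$, this derivation does not come from a vector field of weight $\ell$, i.e. there is no $X\in\mathfrak{g}_\ell(h)$ with $D_\ell^A(Y)=[X,Y]$ for all $Y\in\mathfrak{m}$. The derivations $D_\ell^A$ are called derivations of the second kind.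
   Context: The dilation $h$ of $\mathbb{R}^n$ (coordinates $x^1,\dots,x^n$) with signature of positive integers $r_1\le\dots\le r_n$ is $h_t(x^1,\dots,x^n)=(t^{r_1}x^1,\dots,t^{r_n}x^n)$, with weight vector field $\nabla^h=\sum_i r_i x^i\partial_{x^i}$. For $k\in\mathbb{Z}$, $\mathfrak{g}_k(h)$ is the real vector space of smooth vector fields $X$ on $\mathbb{R}^n$ with $[\nabla^h,X]=kX$ (vector fields of weight $k$); these are automatically polynomial, $\mathfrak{g}_k(h)=0$ for $k<-r_n$, and $[\mathfrak{g}_k(h),\mathfrak{g}_l(h)]\subset\mathfrak{g}_{k+l}(h)$. For example $x^i\partial_{x^j}\in\mathfrak{g}_{r_i-r_j}(h)$. $\mathfrak{m}=\mathfrak{g}_{<0}(h)=\bigoplus_{p=-r_n}^{-1}\mathfrak{g}_p(h)$ is a finite-dimensional nilpotent graded Lie algebra. An element $D\in\bigoplus_{p<0}\mathfrak{g}_{p+\ell}(h)\otimes\mathfrak{g}_p(h)^*$ is a linear map $D$ from $\mathfrak{m}$ to polynomial vector fields with $D(\mathfrak{g}_p(h))\subset\mathfrak{g}_{p+\ell}(h)$ for all $p<0$; it is a derivation of weight $\ell$ if $D([X,Y])=[D(X),Y]+[X,D(Y)]$ for all $X,Y\in\mathfrak{m}$, the brackets being the usual brackets of vector fields. The symbol $\delta_j^n$ is the Kronecker delta.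
   Formalization: The last claim, that the derivation does not come from a vector field of weight ℓ, is stated only for A ≠ 0: for A = 0 the derivation is zero and comes from the zero vector field. Existence and uniqueness are stated for all A. *)

(* Defs.v *)
From HB Require Import structures.
From mathcomp Require Import all_boot all_order all_algebra.
From mathcomp Require Import all_classical all_reals all_analysis.
Set Implicit Arguments.
Unset Strict Implicit.
Unset Printing Implicit Defensive.

Import Order.TTheory GRing.Theory Num.Theory.
Import numFieldNormedType.Exports.

Local Open Scope classical_set_scope.
Local Open Scope ring_scope.

(* Fields on R^d are identified with maps R^d -> R^d; smoothness is required
   separately. *)
Definition vfield (R : realType) (d : nat) := 'rV[R]_d -> 'rV[R]_d.

Fixpoint class_C (R : realType) (d k : nat) (X : vfield R d) : Prop :=
  match k with
  | 0%N => continuous X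
  | k'.+1 => continuous X /\
      forall i : 'I_d,
        (forall x, derivable X x (delta_mx 0 i)) /\
        class_C k' (fun x => 'D_(delta_mx 0 i) X x)
  end.

Definition smooth (R : realType) (d : nat) (X : vfield R d) : Prop :=
  forall k, class_C k X.

(* In coordinates, [X, Y]^j = \sum_i (X^i d_i Y^j - Y^i d_i X^j). *)
Definition lie (R : realType) (d : nat) (X Y : vfield R d) : vfield R d :=
  fun x => 'D_(X x) Y x - 'D_(Y x) X x.

Definition partial_vf (R : realType) (d : nat) (i : 'I_d) : vfield R d :=
  fun _ => delta_mx 0 i.
Arguments partial_vf R {d} i.

(* x^i d/dx^j *)
Definition linear_vf (R : realType) (d : nat) (i j : 'I_d) : vfield R d :=
  fun x => x 0 i *: delta_mx 0 j.
Arguments linear_vf R {d} i j.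

Definition weight_vf (R : realType) (d : nat) (r : 'I_d -> nat) : vfield R d :=
  fun x => \sum_i ((r i)%:R * x 0 i) *: delta_mx 0 i.
Arguments weight_vf R {d} r.

Definition weight_space (R : realType) (d : nat) (r : 'I_d -> nat) (k : int) :
    set (vfield R d) :=
  [set X | smooth X /\ forall x, lie (weight_vf R r) X x = k%:~R *: X x].
Arguments weight_space R {d} r k.

(* The summand of index p has weight - p. *)
Definition negative_part (R : realType) (d : nat) (r : 'I_d.+1 -> nat) :
    set (vfield R d.+1) :=
  [set X | exists2 Y : nat -> vfield R d.+1,
      forall p, (0 < p)%N -> weight_space R r (- p%:Z) (Y p) &
      forall x, X x = \sum_(1 <= p < (r ord_max).+1) Y p x].
Arguments negative_part R {d} r.

(* A linear map defined on the negative part is represented by a total map,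
   of which only the values on the negative part are constrained. *)
Definition weighted_derivation (R : realType) (d : nat) (r : 'I_d.+1 -> nat)
    (l : int) (D : vfield R d.+1 -> vfield R d.+1) : Prop :=
  let m := negative_part R r in
  [/\ forall (a : R) (X Y : vfield R d.+1), m X -> m Y ->
        D (fun x => a *: X x + Y x) = (fun x => a *: D X x + D Y x),
      forall (p : int) (X : vfield R d.+1), p < 0 ->
        weight_space R r p X -> weight_space R r (p + l) (D X) &
      forall X Y : vfield R d.+1, m X -> m Y ->
        D (lie X Y) = (fun x => lie (D X) Y x + lie X (D Y) x)].

(* The inclusion of the first n.+1 coordinate indices into all n.+2 of them;
   ord_max is the last coordinate index, low ord_max the penultimate one. *)
Definition low (n : nat) (i : 'I_n.+1) : 'I_n.+2 := widen_ord (leqnSn n.+1) i.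

(* In the last clause the index i runs over the first n.+1 coordinates only:
   for a nondecreasing r, the last coordinate never satisfies r i < r j. *)
Definition second_kind_derivation (R : realType) (n : nat)
    (r : 'I_n.+2 -> nat) (A : 'M[R]_n.+1) (l : int)
    (D : vfield R n.+2 -> vfield R n.+2) : Prop :=
  [/\ weighted_derivation r l D,
      forall i : 'I_n.+2, D (partial_vf R i) = (fun=> 0) &
      forall (i : 'I_n.+1) (j : 'I_n.+2), (r (low i) < r j)%N ->
        D (linear_vf R (low i) j) =
        (fun x => (j == ord_max)%:R *:
                  \sum_(k < n.+1) A i k *: partial_vf R (low k) x)].

(* Main.v *)
Require Import Defs.
From HB Require Import structures.
From mathcomp Require Import all_boot all_order all_algebra.
From mathcomp Require Import all_classical all_reals all_analysis.
From mathcomp Require Import ring zify.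
Set Implicit Arguments.
Unset Strict Implicit.
Unset Printing Implicit Defensive.

Import Order.TTheory GRing.Theory Num.Theory.
Import numFieldNormedType.Exports.

Local Open Scope classical_set_scope.
Local Open Scope ring_scope.

(* The derivation is X |-> sum_{i,k} a_i^k (d_i X^n) d_k.  A field X of negative
   weight satisfies d_i X^j = 0 whenever r_j <= r_i: this component has negative
   weight for h, and a homogeneous function f of weight -m < 0 vanishes because
   t^m f(h_t x) is constant in t.  With the support condition on A this kills
   the terms d_i X^m d_m Y^n in D [X, Y], and the symmetry of A makes the
   remaining n-th component of [D X, Y] + [X, D Y] cancel.

   For uniqueness, let Z be the difference of the values of two such derivations
   at X = f d_j of weight p < 0.  By induction on the weight of X, Z commutes
   with all d_i, hence it is a constant combination of the d_a with
   r_a = - p - l.  If f is not constant then r_a < r_j, so that x^a d_j lies in m;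
   since it commutes with X and both derivations agree on it, it commutes with Z
   too, which forces Z^a = 0.

   If D = [X, -] then X commutes with all d_i, so X is constant of weight l >= 0;
   thus X = 0 and D = 0. *)

(** * Mean value theorem along lines and Schwarz's theorem *)

Section DirectionalDerivatives.
Context {R : realType} {V : normedModType R}.
Implicit Types (f : V -> R) (u v x y : V).

Lemma is_derive_line f v x (s : R) :
  derivable f (s *: v + x) v ->
  is_derive s 1 (fun h => f (h *: v + x)) ('D_v f (s *: v + x)).
Proof.
move=> dfs; have E : (fun h : R => h^-1 *: (f ((h *: 1 + s) *: v + x) -
    f (s *: v + x))) = (fun h => h^-1 *: (f (h *: v + (s *: v + x)) -
    f (s *: v + x))).
  by apply/funext => h; rewrite [h *: 1]mulr1 scalerDl addrA.
split; first by rewrite /derivable /= E.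
by rewrite /derive /= E.
Qed.

(** The mean value theorem on the segment between 0 and [t], for either sign of [t]. Bounding [s] by
    [|t|] alone is enough to keep intermediate points inside a ball. *)
Lemma MVT_line f v x (t : R) : (forall y, derivable f y v) ->
  exists2 s, `|s| <= `|t| & f (t *: v + x) - f x = t * 'D_v f (s *: v + x).
Proof.
move=> dfv; pose g (h : R) := f (h *: v + x).
have dg (s : R) : is_derive s 1 g ('D_v f (s *: v + x)).
  exact: is_derive_line.
have cg (a b : R) : {within `[a, b], continuous g}.
  by apply: derivable_within_continuous => s _; have [] := dg s.
have g0 : g 0 = f x by rewrite /g scale0r add0r.
have [t0|t0] := leP 0 t.
  have [s] := MVT_segment t0 (fun s _ => dg s) (cg 0 t).
  rewrite in_itv/= => /andP[s0 st]; rewrite g0 subr0 => E.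
  by exists s; [rewrite !ger0_norm|rewrite mulrC -E].
have [s] := MVT_segment (ltW t0) (fun s _ => dg s) (cg t 0).
rewrite in_itv/= => /andP[ts s0]; rewrite g0 sub0r mulrN => E.
exists s; first by rewrite !ler0_norm ?lerN2 // ltW.
by rewrite mulrC -[RHS]opprK -E opprB.
Qed.

Lemma derivable_shift f u c x : derivable f (c + x) u ->
  derivable (fun y => f (c + y)) x u.
Proof.
by rewrite /derivable; under [in X in _ -> X]eq_fun do rewrite /= addrCA.
Qed.

Lemma derive_shiftl f u c x : 'D_u (fun y => f (c + y)) x = 'D_u f (c + x).
Proof. by rewrite /derive; under eq_fun do rewrite /= addrCA. Qed.

(** Two applications of the mean value theorem: along [u] to the increment y -> f (t v + y) - f y,
    then along [v] to ['D_u f]. *)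
Lemma second_difference f u v x (t : R) :
  (forall y, derivable f y u) -> (forall y, derivable ('D_u f) y v) ->
  exists s1 s2, [/\ `|s1| <= `|t|, `|s2| <= `|t| &
    f (t *: v + (t *: u + x)) - f (t *: u + x) - (f (t *: v + x) - f x) =
    t * (t * 'D_v ('D_u f) (s2 *: v + (s1 *: u + x)))].
Proof.
move=> du dvu; pose g y := f (t *: v + y) - f y.
have dg y : derivable g y u.
  by apply: derivableB => //; exact: derivable_shift.
have [s1 s1t E1] := MVT_line x t dg.
have [s2 s2t E2] := MVT_line (s1 *: u + x) t dvu.
exists s1, s2; split => //; rewrite -E2.
have -> : 'D_u f (t *: v + (s1 *: u + x)) - 'D_u f (s1 *: u + x) =
    'D_u g (s1 *: u + x).
  by rewrite deriveB ?derive_shiftl //; exact: derivable_shift.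
by rewrite -E1.
Qed.

(** The second difference is symmetric in [u] and [v], so the two mixed derivatives coincide at two
    possibly different points near [x]. Continuity at [x] then brings their values at [x] within any
    [e] of each other. *)
Lemma derive_comm f u v x :
  (forall y, derivable f y u) -> (forall y, derivable f y v) ->
  (forall y, derivable ('D_u f) y v) -> (forall y, derivable ('D_v f) y u) ->
  {for x, continuous ('D_v ('D_u f))} -> {for x, continuous ('D_u ('D_v f))} ->
  'D_v ('D_u f) x = 'D_u ('D_v f) x.
Proof.
move=> du dv duv dvu /cvgrPdist_lt c1 /cvgrPdist_lt c2.
apply/eqP; rewrite -subr_eq0 -normr_le0; apply/ler_addgt0Pr => e e0.
rewrite add0r; have e2 : 0 < e / 2 by rewrite divr_gt0.
have /nbhs_ballP[d d0 dP] : \forall y \near x,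
    `|'D_v ('D_u f) x - 'D_v ('D_u f) y| < e / 2 /\
    `|'D_u ('D_v f) x - 'D_u ('D_v f) y| < e / 2.
  by apply/near_andP; split; [exact: c1|exact: c2].
(* With t = d / M every displacement a w1 + b w2 with |a|, |b| <= t has norm less than [d]; the
   added 1 keeps [M] positive when [u] and [v] vanish. *)
pose M := `|u| + `|v| + 1; have M0 : 0 < M.
  by rewrite (@le_lt_trans _ _ (`|u| + `|v|)) ?addr_ge0 ?ltrDl.
pose t := d / M; have t0 : 0 < t by rewrite divr_gt0.
have tP (a b : R) w1 w2 : `|w1| + `|w2| = `|u| + `|v| ->
    `|a| <= `|t| -> `|b| <= `|t| -> ball x d (a *: w1 + (b *: w2 + x)).
  move=> w12 at' bt; rewrite -ball_normE /= addrA opprD addrCA subrr addr0.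
  rewrite normrN (le_lt_trans (ler_normD _ _))// !normrZ.
  rewrite (@le_lt_trans _ _ (`|t| * (`|u| + `|v|)))//.
    by rewrite -w12 mulrDr lerD// ler_wpM2r.
  rewrite gtr0_norm// /t -mulrA gtr_pMr// mulrC ltr_pdivrMr// mul1r.
  by rewrite /M ltrDl.
have [a1 [a2 [a1t a2t E1]]] := second_difference x t du duv.
have [b1 [b2 [b1t b2t E2]]] := second_difference x t dv dvu.
have E : 'D_v ('D_u f) (a2 *: v + (a1 *: u + x)) =
    'D_u ('D_v f) (b2 *: u + (b1 *: v + x)).
  have tn0 : t != 0 by rewrite gt_eqF.
  have : t * (t * 'D_v ('D_u f) (a2 *: v + (a1 *: u + x))) =
      t * (t * 'D_u ('D_v f) (b2 *: u + (b1 *: v + x))).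
    apply: etrans (esym E1) (etrans _ E2); rewrite (addrCA (t *: u)).
    have comm (a b c c' : R) : a - b - (c - c') = a - c - (b - c') by ring.
    exact: comm.
  by move=> /(mulfI tn0)/(mulfI tn0).
have [h1 _] := dP _ (tP a2 a1 v u (addrC _ _) a2t a1t).
have [_ h2] := dP _ (tP b2 b1 u v erefl b2t b1t).
rewrite (splitr e) -(subrKA ('D_v ('D_u f) (a2 *: v + (a1 *: u + x)))).
apply: le_trans (ler_normD _ _) (lerD (ltW h1) _).
by rewrite distrC E; exact: ltW h2.
Qed.

End DirectionalDerivatives.

(** * Continuously differentiable functions *)

(** Passes from an explicit epsilon estimate to the little-o expansion, whose linear part is then
    identified with the differential. *)
Lemma linear_approx_differentiable {R : realType} {V W : normedModType R}
    (f : V -> W) (L : {linear V -> W}) x : continuous L ->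
  (forall e, 0 < e ->
    \forall h \near 0, `|f (h + x) - f x - L h| <= e * `|h|) ->
  differentiable f x.
Proof.
move=> cL fL; have E : f \o shift x = cst (f x) + L +o_ 0 id.
  apply/eqaddoP => e e0; near=> h.
  suff : `|f (h + x) - f x - L h| <= e * `|h| by rewrite -addrA -opprD.
  by near: h; exact: fL.
by apply/diff_locallyP; rewrite (diff_unique cL E).
Unshelve. all: by end_near. Qed.

Section PartialDerivatives.
Context {R : realType} {d : nat}.
Implicit Types (f : 'rV[R]_d -> R) (x v : 'rV[R]_d).

(** The path from [x] to h + x changes one coordinate at a time. On each edge the mean value theorem
    gives a partial derivative at a nearby point, and continuity compares it with the one at [x]. *)
Lemma C1_differentiable f x :
  (forall i y, derivable f y (delta_mx 0 i)) ->
  (forall i, {for x, continuous ('D_(delta_mx 0 i) f)}) -> differentiable f x.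
Proof.
move=> df cf.
pose L (h : 'rV[R]_d) : R := \sum_i h 0 i * 'D_(delta_mx 0 i) f x.
have linL : linear L.
  move=> a u v; rewrite /L scaler_sumr -big_split; apply: eq_bigr => i _ /=.
  by rewrite !mxE mulrDl [_ *: (_ * _)]mulrA.
pose LM := GRing.isLinear.Build _ _ _ _ _ linL.
pose LL : {linear 'rV[R]_d -> R} := HB.pack L LM.
have cL : continuous L.
  have cL1 (c : R) i : continuous (fun h : 'rV[R]_d => h 0 i * c).
    move=> y; apply: continuousM; last exact: cst_continuous.
    by have := @coord_continuous R 1 d 0 i y; exact.
  by apply: continuous_big => [|i _]; [exact: add_continuous|exact: cL1].
apply: (@linear_approx_differentiable R _ _ f LL x cL) => _/posnumP[e].
(* There are [d] edges, each with an error of at most this constant times the norm of [h]. Dividing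
   by [d.+1] also covers d = 0. *)
have e0 : 0 < e%:num / d.+1%:R by rewrite divr_gt0.
have /nbhs_ballP[D D0 DP] : \forall y \near x, forall i : 'I_d,
    `|'D_(delta_mx 0 i) f x - 'D_(delta_mx 0 i) f y| < e%:num / d.+1%:R.
  apply: (@filter_forall _ _ _ (nbhs x) (nbhs_filter x)) => i.
  by have /cvgrPdist_lt := cf i; apply.
apply/nbhs_norm0P; exists D => // h /= hD.
(* The vertices of the path: [H k] keeps the first [k] coordinates of [h], so that [H 0] is 0 and
   [H d] is [h]. *)
pose H k : 'rV[R]_d := \row_j (if (j < k)%N then h 0 j else 0).
have HS (k : 'I_d) : H k.+1 = h 0 k *: delta_mx 0 k + H k.
  apply/rowP => j; rewrite !mxE eqxx /=; have [->|/negPf jk] := eqVneq j k.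
    by rewrite ltnSn ltnn mulr1 addr0.
  by rewrite mulr0 add0r ltnS leq_eqVlt val_eqE jk.
have step (k : 'I_d) : `|f (H k.+1 + x) - f (H k + x) -
    h 0 k * 'D_(delta_mx 0 k) f x| <= `|h| * (e%:num / d.+1%:R).
  rewrite HS -(addrA (_ *: _)).
  have [s sh ->] := MVT_line (H k + x) (h 0 k) (df k).
  have hk j : `|h 0 j| <= `|h|.
    rewrite [leRHS]/Num.Def.normr/= mx_normrE.
    exact: (le_bigmax _ (fun i : 'I_1 * 'I_d => `|h i.1 i.2|) (0, j)).
  rewrite -mulrBr normrM ler_pM// distrC ltW//; apply: DP.
  rewrite -ball_normE /= addrA opprD addrCA subrr addr0 normrN.
  apply: le_lt_trans hD.
  rewrite [leLHS]/Num.Def.normr/= mx_normrE; apply/bigmax_leP; split => //.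
  move=> [i j] _ /=; rewrite !mxE (ord1 i) eqxx /=.
  have [->|_] := eqVneq j k; first by rewrite ltnn mulr1 addr0 (le_trans sh).
  by rewrite mulr0 add0r; case: ifP => _ //; rewrite normr0.
have Hd : H d = h by apply/rowP => j; rewrite !mxE ltn_ord.
have H0 : H 0%N = 0 by apply/rowP => j; rewrite !mxE ltn0.
have T : f (h + x) - f x = \sum_(k < d) (f (H k.+1 + x) - f (H k + x)).
  rewrite -(big_mkord xpredT (fun k => f (H k.+1 + x) - f (H k + x))).
  by rewrite telescope_sumr// Hd H0 add0r.
have -> : f (h + x) - f x - LL h =
    \sum_(k < d) (f (H k.+1 + x) - f (H k + x) -
      h 0 k * 'D_(delta_mx 0 k) f x).
  by rewrite sumrB -T.
apply: (le_trans (ler_norm_sum _ _ _)).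
apply: (le_trans (ler_sum _ (fun k _ => step k))).
rewrite sumr_const card_ord -mulrnAr mulrC ler_wpM2r//.
rewrite -mulr_natr -mulrA ler_piMr// mulrC ler_pdivrMr// mul1r ler_nat.
exact: leqnSn.
Qed.

Lemma derive_partials f x v : differentiable f x ->
  'D_v f x = \sum_i v 0 i * 'D_(delta_mx 0 i) f x.
Proof.
move=> df; rewrite deriveE// [in LHS](row_sum_delta v) linear_sum /=.
by apply: eq_bigr => i _; rewrite linearZ/= deriveE.
Qed.

End PartialDerivatives.

(** * Smooth vector fields *)

Section LinearComposition.
Context {R : realType} {U V W : normedModType R}.

Lemma is_derive_linear (L : {linear V -> W}) (f : U -> V) x v :
  continuous L -> derivable f x v ->
  is_derive x v (L \o f) (L ('D_v f x)).
Proof.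
move=> cL df.
have : h^-1 *: ((L \o f) (h *: v + x) - (L \o f) x) @[h --> 0^'] -->
    L ('D_v f x).
  rewrite (_ : (fun h => _) =
    L \o (fun h : R => h^-1 *: (f (h *: v + x) - f x))); last first.
    by apply/funext => h; rewrite /= linearZZ; congr (_ *: _); rewrite linearB.
  apply: (@continuous_cvg _ _ _ ((0 : R)^') _
    (fun h : R => h^-1 *: (f (h *: v + x) - f x)) L ('D_v f x) (cL _)).
  exact: df.
move=> cLf; split; first by apply/cvg_ex; exists (L ('D_v f x)); exact: cLf.
exact: cvg_lim.
Qed.

End LinearComposition.

Lemma mulmx_continuous {R : realType} {d e : nat} (M : 'M[R]_(d, e)) :
  continuous (mulmxr M : 'rV[R]_d -> 'rV[R]_e).
Proof.
have -> : (mulmxr M : 'rV[R]_d -> 'rV[R]_e) =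
    fun y => \sum_i y 0 i *: row i M.
  by apply/funext => y; rewrite /= mulmx_sum_row.
have cZ i : continuous (fun y : 'rV[R]_d => y 0 i *: row i M).
  move=> y; apply: differentiable_continuous.
  by apply: differentiableZl; exact: differentiable_coord.
by apply: continuous_big => [|i _]; [exact: add_continuous|exact: cZ].
Qed.

Section SmoothFields.
Context {R : realType} {d : nat}.
Implicit Types (X Y : vfield R d) (x v : 'rV[R]_d).

Lemma is_derive_mulmx X (M : 'M[R]_d) x v : derivable X x v ->
  is_derive x v (fun y => X y *m M) ('D_v X x *m M).
Proof.
move=> dX; have := is_derive_linear (L := mulmxr M) _ dX.
by apply; exact: mulmx_continuous.
Qed.

Lemma class_C_continuous k X : class_C k X -> continuous X.
Proof. by case: k => [|k] //= []. Qed.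

Lemma class_C_cst k (c : 'rV[R]_d) : class_C k (fun=> c).
Proof.
elim: k c => [|k IHk] c /=; first exact: cst_continuous.
split=> [|i]; first exact: cst_continuous.
split=> [x|]; first exact: derivable_cst.
suff -> : (fun x => 'D_(delta_mx 0 i) (fun=> c) x) = (fun=> 0 : 'rV[R]_d).
  exact: IHk.
by apply/funext => x; exact: derive_cst.
Qed.

Lemma class_C_id k : class_C k (id : vfield R d).
Proof.
case: k => [|k] /=; first by move=> x.
split=> [x|i]; first by [].
split=> [x|]; first exact: derivable_id.
suff -> : (fun x => 'D_(delta_mx 0 i) (id : vfield R d) x) =
    (fun=> delta_mx 0 i).
  exact: class_C_cst.
by apply/funext => x; exact: derive_id.
Qed.

(** Coordinate projections of fields, linear fields and the derivation itself are all built with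
    constant matrices, so this stands in for closure of smoothness under products. *)
Lemma class_C_mulmx k X (M : 'M[R]_d) :
  class_C k X -> class_C k (fun x => X x *m M).
Proof.
have cM Y : continuous Y -> continuous (fun x => Y x *m M).
  move=> cY x; apply: (@continuous_comp _ _ _ Y (mulmxr M)); first exact: cY.
  exact: mulmx_continuous.
elim: k X => [|k IHk] X /=; first exact: cM.
move=> [cX pX]; split; first exact: cM.
move=> i; have [dX CX] := pX i.
split=> [x|]; first by have [] := is_derive_mulmx M (dX x).
suff -> : (fun x => 'D_(delta_mx 0 i) (fun y => X y *m M) x) =
    (fun x => 'D_(delta_mx 0 i) X x *m M).
  exact: IHk.
by apply/funext => x; have /@derive_val := is_derive_mulmx M (dX x).
Qed.

Lemma class_C_linear k (a : R) X Y :
  class_C k X -> class_C k Y -> class_C k (fun x => a *: X x + Y x).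
Proof.
have cD (X' Y' : vfield R d) : continuous X' -> continuous Y' ->
    continuous (fun x => a *: X' x + Y' x).
  move=> cX cY x.
  have cZ := @continuousZl_tmp R 'rV[R]_d 'rV[R]_d X' a x (cX x).
  by have := @continuousD R 'rV[R]_d 'rV[R]_d _ _ x cZ (cY x); exact.
elim: k X Y => [|k IHk] X Y /=; first exact: cD.
move=> [cX pX] [cY pY]; split; first exact: cD.
move=> i; have [dX CX] := pX i; have [dY CY] := pY i.
have dE x : is_derive x (delta_mx 0 i) (fun y => a *: X y + Y y)
    (a *: 'D_(delta_mx 0 i) X x + 'D_(delta_mx 0 i) Y x).
  by apply: is_deriveD; [apply: is_deriveZ|]; exact: derivableP.
split=> [x|]; first by have [] := dE x.
suff -> : (fun x => 'D_(delta_mx 0 i) (fun y => a *: X y + Y y) x) =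
    (fun x => a *: 'D_(delta_mx 0 i) X x + 'D_(delta_mx 0 i) Y x).
  exact: IHk.
by apply/funext => x; have /@derive_val := dE x.
Qed.

Lemma smooth_cst (c : 'rV[R]_d) : smooth (fun=> c).
Proof. by move=> k; exact: class_C_cst. Qed.

Lemma smooth_id : smooth (id : vfield R d).
Proof. by move=> k; exact: class_C_id. Qed.

Lemma smooth_mulmx X (M : 'M[R]_d) : smooth X -> smooth (fun x => X x *m M).
Proof. by move=> sX k; exact: class_C_mulmx. Qed.

Lemma smooth_linear (a : R) X Y :
  smooth X -> smooth Y -> smooth (fun x => a *: X x + Y x).
Proof. by move=> sX sY k; exact: class_C_linear. Qed.

Lemma smooth_sum (I : Type) (s : seq I) (F : I -> vfield R d) :
  (forall i, smooth (F i)) -> smooth (fun x => \sum_(i <- s) F i x).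
Proof.
move=> sF; elim: s => [|i s IHs].
  suff -> : (fun x => \sum_(i <- [::]) F i x) = (fun=> 0).
    exact: smooth_cst.
  by apply/funext => x; rewrite big_nil.
suff -> : (fun x => \sum_(j <- i :: s) F j x) =
    (fun x => 1 *: F i x + \sum_(j <- s) F j x).
  exact: smooth_linear.
by apply/funext => x; rewrite big_cons scale1r.
Qed.

Lemma smooth_derive X i : smooth X -> smooth ('D_(delta_mx 0 i) X).
Proof. by move=> sX k; have [_ /(_ i)[]] := sX k.+1. Qed.

Lemma smooth_derivable_partial X i x :
  smooth X -> derivable X x (delta_mx 0 i).
Proof. by move=> sX; have [_ /(_ i)[]] := sX 1%N. Qed.

Lemma derivable_coord X j x v :
  derivable X x v -> derivable (fun y => X y 0 j) x v.
Proof. by move=> /derivable_mxP. Qed.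

Lemma derive_coord X j x v : derivable X x v ->
  'D_v (fun y => X y 0 j) x = 'D_v X x 0 j.
Proof. by move=> /derive_mx ->; rewrite mxE. Qed.

Lemma smooth_continuous_coord X j : smooth X -> continuous (fun x => X x 0 j).
Proof.
move=> sX x; apply: (@continuous_comp _ _ _ X (fun v => v 0 j)).
  exact: (class_C_continuous (sX 0%N)).
by have := @coord_continuous R 1 d 0 j (X x); exact.
Qed.

Lemma smooth_differentiable_coord X j x :
  smooth X -> differentiable (fun y => X y 0 j) x.
Proof.
move=> sX; apply: C1_differentiable => [i y|i].
  by apply: derivable_coord; exact: smooth_derivable_partial.
suff -> : 'D_(delta_mx 0 i) (fun y => X y 0 j) =
    (fun y => 'D_(delta_mx 0 i) X y 0 j).
  by apply: smooth_continuous_coord; exact: smooth_derive.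
by apply/funext => y; apply: derive_coord; exact: smooth_derivable_partial.
Qed.

(** The definition of smoothness only gives derivatives along the coordinate axes; other directions
    come from differentiability of each component, which is of class C^1. *)
Lemma smooth_derivable X x v : smooth X -> derivable X x v.
Proof.
move=> sX; apply/derivable_mxP => i j; rewrite (ord1 i).
by apply: diff_derivable; exact: smooth_differentiable_coord.
Qed.

Lemma smooth_deriveE X x v j : smooth X ->
  'D_v X x 0 j = \sum_i v 0 i * 'D_(delta_mx 0 i) X x 0 j.
Proof.
move=> sX; rewrite -derive_coord; last exact: smooth_derivable.
rewrite derive_partials; last exact: smooth_differentiable_coord.
apply: eq_bigr => i _; rewrite derive_coord //.
exact: smooth_derivable_partial.
Qed.

Lemma smooth_derive_comm X i k x : smooth X ->
  'D_(delta_mx 0 i) ('D_(delta_mx 0 k) X) x =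
  'D_(delta_mx 0 k) ('D_(delta_mx 0 i) X) x.
Proof.
move=> sX; apply/rowP => j.
have dj Y a : smooth Y -> 'D_(delta_mx 0 a) (fun y => Y y 0 j) =
    fun y => 'D_(delta_mx 0 a) Y y 0 j.
  move=> sY; apply/funext => y; apply: derive_coord.
  exact: smooth_derivable_partial.
have dd a b : 'D_(delta_mx 0 a) ('D_(delta_mx 0 b) (fun y => X y 0 j)) =
    fun y => 'D_(delta_mx 0 a) ('D_(delta_mx 0 b) X) y 0 j.
  by rewrite (dj X b sX) dj//; exact: smooth_derive.
have A1 a y : derivable (fun y => X y 0 j) y (delta_mx 0 a).
  by apply: derivable_coord; exact: smooth_derivable.
have A2 a b y :
    derivable ('D_(delta_mx 0 a) (fun y => X y 0 j)) y (delta_mx 0 b).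
  rewrite dj//; apply: derivable_coord; apply: smooth_derivable.
  exact: smooth_derive.
have A3 a b : {for x, continuous
    ('D_(delta_mx 0 a) ('D_(delta_mx 0 b) (fun y => X y 0 j)))}.
  by rewrite dd; apply: smooth_continuous_coord; do 2 apply: smooth_derive.
have E := derive_comm (A1 k) (A1 i) (A2 k i) (A2 i k) (A3 i k) (A3 k i).
have ddx a b := congr1 (fun g => g x) (dd a b).
exact: etrans (esym (ddx i k)) (etrans E (ddx k i)).
Qed.

End SmoothFields.

Arguments derivable_coord {R d X} j {x v}.
Arguments derive_coord {R d X} j {x v}.

(** * Homogeneous functions and weight spaces *)

Lemma is_derive_exprn {R : realType} n (t : R) :
  is_derive t 1 (fun s : R => s ^+ n) (n%:R * t ^+ n.-1).
Proof.
apply: DeriveDef; first exact: exprn_derivable.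
by rewrite exp_derive [_ *: 1]mulr1.
Qed.

Section Weights.
Context {R : realType} {d : nat}.
Variable r : 'I_d -> nat.
Implicit Types (X Y : vfield R d) (x v : 'rV[R]_d).

Lemma weight_vfE x j : weight_vf R r x 0 j = (r j)%:R * x 0 j.
Proof.
rewrite /weight_vf summxE (bigD1 j) //= big1 => [|i ij].
  by rewrite !mxE !eqxx mulr1 addr0.
by rewrite !mxE [j == i]eq_sym (negPf ij) andbF mulr0.
Qed.

Lemma weight_vf_mulmx : weight_vf R r = mulmxr (diag_mx (\row_i (r i)%:R)).
Proof.
apply/funext => x; apply/rowP => j.
by rewrite weight_vfE /= mul_mx_diag !mxE mulrC.
Qed.

Lemma is_derive_mulmx_id (M : 'M[R]_d) x v :
  is_derive x v (fun y => y *m M) (v *m M).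
Proof.
by have := is_derive_mulmx M (@derivable_id R 'rV[R]_d x v); rewrite derive_id.
Qed.

Lemma lie_weightE X x j :
  lie (weight_vf R r) X x 0 j =
  'D_(weight_vf R r x) X x 0 j - (r j)%:R * X x 0 j.
Proof.
rewrite /lie !mxE; congr (_ - _).
rewrite -weight_vfE weight_vf_mulmx.
have h := is_derive_mulmx_id (diag_mx (\row_i (r i)%:R)) x (X x).
by have /@derive_val -> := h.
Qed.

(** Since the weight field is linear, the bracket condition becomes Euler's identity for each
    component: X^j is homogeneous of weight [k + r j]. *)
Lemma weight_spaceP k X :
  weight_space R r k X <-> smooth X /\
    forall x j, 'D_(weight_vf R r x) X x 0 j = (k + r j)%:~R * X x 0 j.
Proof.
split=> -[sX wX]; split=> // x; last first.
  by apply/rowP => j; rewrite lie_weightE wX mxE intrD mulrDl addrK.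
move=> j; have := congr1 (fun v : 'rV[R]_d => v 0 j) (wX x).
by rewrite /= lie_weightE mxE intrD mulrDl => /eqP; rewrite subr_eq => /eqP.
Qed.

(** By Euler's identity [phi] has zero derivative on the whole real line, so its value [f x] at 1
    equals its value at 0, where the positive power [m.+1] of t kills it. *)
Lemma negative_homogeneous (f : 'rV[R]_d -> R) (w : int) :
  (forall x, differentiable f x) -> w < 0 ->
  (forall x, 'D_(weight_vf R r x) f x = w%:~R * f x) -> forall x, f x = 0.
Proof.
move=> df w0 wf x.
have [m wE] : exists m : nat, w = - (m.+1)%:Z by exists (`|w|.-1)%N; lia.
pose c (t : R) : 'rV[R]_d := \row_i (t ^+ r i * x 0 i).
pose c' (t : R) : 'rV[R]_d := \row_i ((r i)%:R * t ^+ (r i).-1 * x 0 i).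
have dci (t : R) i :
    is_derive t 1 (fun s : R => s ^+ r i * x 0 i) (c' t 0 i).
  have dX := is_derive_exprn (r i) t.
  have dC : is_derive t 1 (cst (x 0 i) : R -> R) 0 by exact: is_derive_cst.
  have h := is_deriveM dX dC; apply: is_derive_eq h _.
  rewrite scaler0 add0r mxE.
  exact: mulrC.
have dc (t : R) : is_derive t 1 c (c' t).
  have dct : derivable c t 1.
    apply/derivable_mxP => a b; rewrite (ord1 a).
    have -> : (fun s => c s 0 b) = (fun s => s ^+ r b * x 0 b).
      by apply/funext => s; rewrite mxE.
    by have [] := dci t b.
  split=> //; rewrite derive_mx//; apply/rowP => b; rewrite mxE.
  have -> : (fun s => c s 0 b) = (fun s => s ^+ r b * x 0 b).
    by apply/funext => s; rewrite mxE.
  by have /@derive_val := dci t b.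
(* The orbit follows the weight field up to the factor [t], which restores the exponent [(r i).-1]
   to [r i]; if [r i] is 0, both sides have a zero coefficient. *)
have tc' (t : R) : t *: c' t = weight_vf R r (c t).
  apply/rowP => i; rewrite weight_vfE !mxE.
  by case: (r i) => [|k] /=; rewrite ?mul0r ?mulr0// exprS; ring.
have dfc (t : R) : is_derive t 1 (f \o c) ('D_(c' t) f (c t)).
  have dct : differentiable c t.
    by apply/derivable1_diffP; have [] := dc t.
  split.
    by apply: diff_derivable; exact: differentiable_comp.
  rewrite deriveE; last exact: differentiable_comp.
  rewrite diff_comp//= -!deriveE//.
  by have /@derive_val -> := dc t.
pose phi (t : R) := t ^+ m.+1 * f (c t).
have dphi (t : R) : is_derive t 1 phi 0.
  have dX := is_derive_exprn m.+1 t.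
  have h := is_deriveM dX (dfc t); apply: is_derive_eq h _.
  have E : t * 'D_(c' t) f (c t) = w%:~R * f (c t).
    by rewrite -wf -tc' !deriveE// linearZ.
  rewrite -[_ *: 'D_(c' t) f (c t)]/(t ^+ m.+1 * 'D_(c' t) f (c t)).
  rewrite exprSr -mulrA E wE /= -[_ *: _]/(f (c t) * (m.+1%:R * t ^+ m)).
  by rewrite mulrNz -pmulrn; ring.
have phi1 : phi 1 = f x.
  rewrite /phi expr1n mul1r; congr f.
  by apply/rowP => i; rewrite mxE expr1n mul1r.
rewrite -phi1 (is_derive_0_is_cst 1 0 dphi) /phi exprS !mul0r.
by [].
Qed.

End Weights.

(** * Weight spaces under differentiation and constant matrices *)

Section WeightSpaces.
Context {R : realType} {d : nat}.
Variable r : 'I_d -> nat.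
Implicit Types (X Y : vfield R d) (x v : 'rV[R]_d) (k : int).

Lemma weight_space_smooth k X : weight_space R r k X -> smooth X.
Proof. by case. Qed.

Lemma weight_space_coord0 k X j : weight_space R r k X -> k + (r j)%:Z < 0 ->
  forall x, X x 0 j = 0.
Proof.
move=> /weight_spaceP[sX wX] kj.
apply: (@negative_homogeneous _ _ r _ _ _ kj) => [x|x].
  exact: smooth_differentiable_coord.
by rewrite derive_coord; [exact: wX|exact: smooth_derivable].
Qed.

(** Obtained by differentiating Euler's identity along coordinate [i] and exchanging the order of
    the second derivatives. *)
Lemma weight_space_derive k X i : weight_space R r k X ->
  weight_space R r (k - (r i)%:Z) ('D_(delta_mx 0 i) X).
Proof.
move=> /weight_spaceP[sX wX]; apply/weight_spaceP.
split=> [|x j]; first exact: smooth_derive.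
have sD m : smooth ('D_(delta_mx 0 m) X) by exact: smooth_derive.
pose c m (y : 'rV[R]_d) : R := y 0 m.
pose g m (y : 'rV[R]_d) : R := (r m)%:R * 'D_(delta_mx 0 m) X y 0 j.
have dc m : is_derive x (delta_mx 0 i) (c m) (m == i)%:R.
  have did := @derivable_id R 'rV[R]_d x (delta_mx 0 i).
  have h := derivableP (derivable_coord m did).
  rewrite (derive_coord m did) derive_id mxE eqxx in h.
  by exact: h.
have dg m : is_derive x (delta_mx 0 i) (g m)
    ((r m)%:R * 'D_(delta_mx 0 i) ('D_(delta_mx 0 m) X) x 0 j).
  have dD : derivable ('D_(delta_mx 0 m) X) x (delta_mx 0 i).
    exact: smooth_derivable.
  have h := derivableP (derivable_coord j dD).
  rewrite (derive_coord j dD) in h.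
  by have := is_deriveZ (r m)%:R h; exact.
have E : \sum_m (c m * g m) = (k + (r j)%:Z)%:~R \*: (fun y => X y 0 j).
  apply/funext => y; rewrite fct_sumE /= -[RHS]wX smooth_deriveE//.
  apply: eq_bigr => m _.
  rewrite -[LHS]/(y 0 m * ((r m)%:R * _)) weight_vfE.
  by rewrite mulrA [y 0 m * _]mulrC.
have dE := is_derive_sum (fun m => is_deriveM (dc m) (dg m)).
have dX : derivable X x (delta_mx 0 i) by exact: smooth_derivable.
have h := derivableP (derivable_coord j dX).
rewrite (derive_coord j dX) in h.
have dE' := is_deriveZ ((k + (r j)%:Z)%:~R : R) h.
have := @derive_val _ _ _ _ _ _ _ dE.
have := @derive_val _ _ _ _ _ _ _ dE'.
rewrite E => -> E1.
rewrite smooth_deriveE//.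
transitivity ((k + (r j)%:Z)%:~R * 'D_(delta_mx 0 i) X x 0 j -
   (r i)%:R * 'D_(delta_mx 0 i) X x 0 j); last first.
  by rewrite addrAC rmorphB mulrBl.
apply/eqP; rewrite eq_sym subr_eq; apply/eqP.
(* The derivatives of the coordinate factors [c m] contribute only r_i d_i X^j, which is the shift
   of the weight. *)
rewrite [LHS]E1 big_split /= addrC addrC; congr (_ + _).
  apply: eq_bigr => m _; rewrite weight_vfE smooth_derive_comm//.
  by rewrite -[LHS]/(x 0 m * ((r m)%:R * _)); ring.
rewrite (bigD1 i) //= big1 => [|m mi].
  by rewrite eqxx addr0 [_ *: _]mulr1.
by rewrite (negPf mi) scaler0.
Qed.

Lemma negative_weight_derive0 k X i j x : weight_space R r k X -> k < 0 ->
  (r j <= r i)%N -> 'D_(delta_mx 0 i) X x 0 j = 0.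
Proof.
move=> wX k0 ji; apply: (weight_space_coord0 (weight_space_derive i wX)).
by lia.
Qed.

Lemma smooth_coord_cst X j : smooth X ->
  (forall i x, 'D_(delta_mx 0 i) X x 0 j = 0) -> forall x, X x 0 j = X 0 0 j.
Proof.
move=> sX D0 x.
have dX y : derivable (fun z => X z 0 j) y x.
  by apply: derivable_coord; exact: smooth_derivable.
have [s _] := MVT_line 0 1 dX.
rewrite derive_coord; last exact: smooth_derivable.
rewrite smooth_deriveE// big1 => [|i _]; last by rewrite D0 mulr0.
by rewrite mulr0 scale1r addr0 => /eqP; rewrite subr_eq0 => /eqP.
Qed.

(** A nonzero entry of [M] at (a, b) feeds component a into component b, so the Euler weights of
    these components have to match. *)
Lemma weight_space_mulmx k k' X (M : 'M[R]_d) : weight_space R r k X ->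
  (forall a b, M a b != 0 -> k + (r a)%:Z = k' + (r b)%:Z) ->
  weight_space R r k' (fun x => X x *m M).
Proof.
move=> /weight_spaceP[sX wX] kk'; apply/weight_spaceP.
split=> [|x j]; first exact: smooth_mulmx.
have dX : derivable X x (weight_vf R r x) by exact: smooth_derivable.
have /@derive_val -> := is_derive_mulmx M dX.
rewrite !mxE mulr_sumr; apply: eq_bigr => a _; rewrite wX.
have [->|/kk' ->] := eqVneq (M a j) 0; first by rewrite !mulr0.
by rewrite mulrA.
Qed.

Lemma weight_space_linear k (a : R) X Y : weight_space R r k X ->
  weight_space R r k Y -> weight_space R r k (fun x => a *: X x + Y x).
Proof.
move=> /weight_spaceP[sX wX] /weight_spaceP[sY wY]; apply/weight_spaceP.
split=> [|x j]; first exact: smooth_linear.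
have dX : derivable X x (weight_vf R r x) by exact: smooth_derivable.
have dY : derivable Y x (weight_vf R r x) by exact: smooth_derivable.
have h := is_deriveD (is_deriveZ a (derivableP dX)) (derivableP dY).
have := @derive_val _ _ _ _ _ _ _ h.
rewrite -[X in 'D__ X x]/(fun y => a *: X y + Y y) => ->.
by rewrite !mxE wX wY; ring.
Qed.

Lemma weight_space0 k : weight_space R r k (fun=> 0).
Proof.
apply/weight_spaceP; split=> [|x j]; first exact: smooth_cst.
have -> : 'D_(weight_vf R r x) (fun=> 0 : 'rV[R]_d) x = 0.
  exact: derive_cst.
by rewrite mxE mulr0.
Qed.

Lemma weight_space_sum k (I : Type) (s : seq I) (F : I -> vfield R d) :
  (forall i, weight_space R r k (F i)) ->
  weight_space R r k (fun x => \sum_(i <- s) F i x).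
Proof.
move=> wF; elim: s => [|i s IHs].
  suff -> : (fun x => \sum_(i <- [::]) F i x) = (fun=> 0).
    exact: weight_space0.
  by apply/funext => x; rewrite big_nil.
suff -> : (fun x => \sum_(j <- i :: s) F j x) =
    (fun x => 1 *: F i x + \sum_(j <- s) F j x).
  exact: weight_space_linear.
by apply/funext => x; rewrite big_cons scale1r.
Qed.

Lemma weight_space_partial i : weight_space R r (- (r i)%:Z) (partial_vf R i).
Proof.
apply/weight_spaceP; split=> [|x j]; first exact: smooth_cst.
have -> : 'D_(weight_vf R r x) (partial_vf R i) x = 0 by exact: derive_cst.
rewrite !mxE eqxx /=; have [->|_] := eqVneq j i; last by rewrite mulr0.
by rewrite addNr mul0r.
Qed.

Lemma linear_vf_mulmx i j : linear_vf R i j = fun x => x *m delta_mx i j.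
Proof.
apply/funext => x; apply/rowP => k; rewrite !mxE.
rewrite (bigD1 i) //= big1 => [|m mi]; rewrite mxE; last first.
  by rewrite (negPf mi) mulr0.
by rewrite !eqxx addr0.
Qed.

Lemma weight_space_linear_vf i j :
  weight_space R r ((r i)%:Z - (r j)%:Z) (linear_vf R i j).
Proof.
(* The identity map, which is the usual Euler field, commutes with the weight field and so has
   weight 0. *)
rewrite linear_vf_mulmx; apply: (@weight_space_mulmx 0 _ id).
  apply/weight_spaceP; split=> [|x m]; first exact: smooth_id.
  by rewrite derive_id weight_vfE add0r.
move=> a b; rewrite mxE.
have [->|_] := eqVneq a i; last by rewrite eqxx.
have [->|_] := eqVneq b j; last by rewrite eqxx.
by move=> _; lia.
Qed.

End WeightSpaces.

(** * Fields of negative weight and the derivation *)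

Section LieBracket.
Context {R : realType} {d : nat}.
Implicit Types (X Y : vfield R d) (x : 'rV[R]_d).

Lemma lie_coordE X Y x j : smooth X -> smooth Y -> lie X Y x 0 j =
  \sum_m (X x 0 m * 'D_(delta_mx 0 m) Y x 0 j -
          Y x 0 m * 'D_(delta_mx 0 m) X x 0 j).
Proof. by move=> sX sY; rewrite sumrB -!smooth_deriveE// !mxE. Qed.

Lemma derive_lie_coord X Y x i j : smooth X -> smooth Y ->
  'D_(delta_mx 0 i) (lie X Y) x 0 j = \sum_m
   (X x 0 m * 'D_(delta_mx 0 i) ('D_(delta_mx 0 m) Y) x 0 j +
    'D_(delta_mx 0 m) Y x 0 j * 'D_(delta_mx 0 i) X x 0 m -
    (Y x 0 m * 'D_(delta_mx 0 i) ('D_(delta_mx 0 m) X) x 0 j +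
    'D_(delta_mx 0 m) X x 0 j * 'D_(delta_mx 0 i) Y x 0 m)).
Proof.
move=> sX sY; pose c m (Z : vfield R d) (y : 'rV[R]_d) : R := Z y 0 m.
have dc Z m : smooth Z ->
    is_derive x (delta_mx 0 i) (c m Z) ('D_(delta_mx 0 i) Z x 0 m).
  move=> sZ; have dZ : derivable Z x (delta_mx 0 i).
    exact: smooth_derivable.
  have h := derivableP (derivable_coord m dZ).
  by rewrite (derive_coord m dZ) in h.
have dXY k : is_derive x (delta_mx 0 i) (fun y => lie X Y y 0 k) (\sum_m
   (X x 0 m * 'D_(delta_mx 0 i) ('D_(delta_mx 0 m) Y) x 0 k +
    'D_(delta_mx 0 m) Y x 0 k * 'D_(delta_mx 0 i) X x 0 m -
    (Y x 0 m * 'D_(delta_mx 0 i) ('D_(delta_mx 0 m) X) x 0 k +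
    'D_(delta_mx 0 m) X x 0 k * 'D_(delta_mx 0 i) Y x 0 m))).
  have -> : (fun y => lie X Y y 0 k) = \sum_m
      (c m X * c k ('D_(delta_mx 0 m) Y) - c m Y * c k ('D_(delta_mx 0 m) X)).
    by apply/funext => y; rewrite fct_sumE lie_coordE.
  have h := is_derive_sum (fun m => is_deriveB
    (is_deriveM (dc X m sX) (dc _ k (smooth_derive m sY)))
    (is_deriveM (dc Y m sY) (dc _ k (smooth_derive m sX)))).
  exact: h.
have dL : derivable (lie X Y) x (delta_mx 0 i).
  by apply/derivable_mxP => a b; rewrite (ord1 a); have [] := dXY b.
by rewrite -(derive_coord j dL); have /@derive_val := dXY j.
Qed.

End LieBracket.

Section NegativePart.
Context {R : realType} {d : nat}.
Variable r : 'I_d.+1 -> nat.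
Implicit Types (X Y : vfield R d.+1) (x : 'rV[R]_d.+1) (k : int).

(** Reduces an additive property of m to homogeneous fields of negative weight. *)
Lemma negative_part_ind (P : vfield R d.+1 -> Prop) :
  P (fun=> 0) -> (forall X Y, P X -> P Y -> P (fun x => X x + Y x)) ->
  (forall k X, k < 0 -> weight_space R r k X -> P X) ->
  forall X, negative_part R r X -> P X.
Proof.
move=> P0 PD Pw X [Y wY XE].
have -> : X = (fun x => \sum_(1 <= p < (r ord_max).+1) Y p x).
  by apply/funext.
elim: (r ord_max) => [|N IHN].
  suff -> : (fun x => \sum_(1 <= p < 1) Y p x) = (fun=> 0) by [].
  by apply/funext => x; rewrite big_geq.
suff -> : (fun x => \sum_(1 <= p < N.+2) Y p x) =
  (fun x => \sum_(1 <= p < N.+1) Y p x + Y N.+1 x).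
  by apply: PD => //; apply: (Pw (- (N.+1)%:Z)) => //; exact: wY.
by apply/funext => x; rewrite big_nat_recr.
Qed.

Lemma negative_part_linear (a : R) X Y : negative_part R r X ->
  negative_part R r Y -> negative_part R r (fun x => a *: X x + Y x).
Proof.
move=> [X' wX XE] [Y' wY YE]; exists (fun p x => a *: X' p x + Y' p x).
  by move=> p p0; apply: weight_space_linear; [exact: wX|exact: wY].
by move=> x; rewrite XE YE scaler_sumr -big_split.
Qed.

Hypothesis r_max : forall i, (r i <= r ord_max)%N.

Lemma negative_weight_space k X : k < 0 -> weight_space R r k X ->
  negative_part R r X.
Proof.
move=> k0 wX; have [m kE] : exists m : nat, k = - m%:Z.
  by exists (`|k|)%N; lia.
have m0 : (0 < m)%N by lia.
(* The decomposition stops at weight [- r ord_max]; a field of lower weight is zero, so the zero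
   family represents it. *)
have [mr|rm] := leqP m (r ord_max); last first.
  exists (fun _ _ => 0) => [p _|x]; first exact: weight_space0.
  rewrite big1 //; apply/rowP => j; rewrite mxE.
  by apply: (weight_space_coord0 wX); have := r_max j; lia.
exists (fun p => if p == m then X else fun=> 0) => [p p0|x].
  by case: eqP => [->|_]; [rewrite -kE|exact: weight_space0].
rewrite (bigD1_seq m) ?mem_index_iota ?m0 ?ltnS ?iota_uniq //= eqxx.
by rewrite big1 ?addr0 // => p /negPf ->.
Qed.

(** The component X^j depends only on coordinates of weight strictly less than [r j]. This is all
    that the derivation rule needs to know about m. *)
Definition flag_field X := smooth X /\
  forall i j x, (r j <= r i)%N -> 'D_(delta_mx 0 i) X x 0 j = 0.

Lemma negative_part_flag X : negative_part R r X -> flag_field X.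
Proof.
apply: negative_part_ind => {X} [|X Y [sX DX] [sY DY]|k X k0 wX].
- split=> [|i j x _]; first exact: smooth_cst.
  have -> : 'D_(delta_mx 0 i) (fun=> 0 : 'rV[R]_d.+1) x = 0.
    exact: derive_cst.
  by rewrite mxE.
- split=> [|i j x ji].
    have := smooth_linear 1 sX sY; congr smooth.
    by apply/funext => x; rewrite scale1r.
  have dX : derivable X x (delta_mx 0 i) by exact: smooth_derivable.
  have dY : derivable Y x (delta_mx 0 i) by exact: smooth_derivable.
  have -> : 'D_(delta_mx 0 i) (fun x => X x + Y x) x =
      'D_(delta_mx 0 i) X x + 'D_(delta_mx 0 i) Y x by exact: deriveD.
  by rewrite mxE DX// DY// addr0.
- split=> [|i j x ji]; first exact: weight_space_smooth wX.
  exact: (negative_weight_derive0 x wX).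
Qed.

End NegativePart.

(* The identity [D (lie X Y) = lie (D X) Y + lie X (D Y)] at a point and in the
   coordinate [k]: [a m], [b m] stand for the values of [X^m], [Y^m], while
   [PX i m] is [d_i X^m] and [QX i m] is [d_i d_m X^N], and likewise for [Y]. *)
Lemma second_kind_identity {R : comPzRingType} {I : finType} (B : I -> I -> R)
    (N k : I) (a b : I -> R) (PX PY QX QY : I -> I -> R) :
  (forall i j, B i j = B j i) ->
  (forall i m, PY m N * PX i m * B i k = 0) ->
  (forall i m, PX m N * PY i m * B i k = 0) ->
  k = N \/ (forall i m, B i m * PX m k = 0 /\ B i m * PY m k = 0) ->
  \sum_i (\sum_m (a m * QY i m + PY m N * PX i m -
    (b m * QX i m + PX m N * PY i m))) * B i k =
  \sum_m ((\sum_i PX i N * B i m) * PY m k - b m * \sum_i QX i m * B i k) +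
  \sum_m (a m * (\sum_i QY i m * B i k) - (\sum_i PY i N * B i m) * PX m k).
Proof.
move=> B_sym fXY fYX hk.
(* These are the two sums without second derivatives on the right-hand side of the goal. For k = N
   the symmetry of [B] makes them equal; otherwise all their terms vanish. *)
have Z0 : \sum_m (\sum_i PX i N * B i m) * PY m k =
    \sum_m (\sum_i PY i N * B i m) * PX m k.
  under eq_bigr do rewrite mulr_suml.
  under [RHS]eq_bigr do rewrite mulr_suml.
  case: hk => [->|hk].
    rewrite exchange_big; apply: eq_bigr => i _; apply: eq_bigr => m _ /=.
    by rewrite B_sym; ring.
  apply: eq_bigr => m _; apply: eq_bigr => i _.
  by have [hX hY] := hk i m; rewrite -!mulrA hX hY !mulr0.
have comm (u : I -> R) (Q : I -> I -> R) :
    \sum_m u m * (\sum_i Q i m * B i k) =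
    \sum_i (\sum_m u m * Q i m) * B i k.
  under eq_bigr do rewrite mulr_sumr.
  under [RHS]eq_bigr do rewrite mulr_suml.
  rewrite exchange_big; apply: eq_bigr => i _; apply: eq_bigr => m _.
  by rewrite mulrA.
rewrite [RHS]addrC !sumrB Z0 addrA subrK !comm -sumrB.
apply: eq_bigr => i _; rewrite -mulrBl -sumrB !mulr_suml.
(* Adding the difference of the two vanishing products cancels the first-order terms on the left. *)
apply: eq_bigr => m _; rewrite -[LHS]addr0 -[X in _ + X](subrr 0).
by rewrite -{1}(fYX i m) -(fXY i m); ring.
Qed.

(** * The derivation attached to a symmetric matrix *)

Section SecondKindMap.
Context {R : realType} {d : nat}.
Variables (r : 'I_d.+1 -> nat) (B : 'M[R]_d.+1) (rho : nat).
Hypothesis B_sym : forall i j, B i j = B j i.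
Hypothesis B_supp : forall i j, B i j != 0 -> r i = rho.
Hypothesis rho_max : forall j, j != ord_max -> (r j <= rho)%N.
Implicit Types (X Y : vfield R d.+1) (x : 'rV[R]_d.+1).

(** The matrix attached to [i] sends the last component to row [i] of [B]. In this form smoothness
    and weights follow from the results on constant matrices. *)
Definition second_kind_map X : vfield R d.+1 := fun x =>
  \sum_i 'D_(delta_mx 0 i) X x *m \matrix_(a, b) ((a == ord_max)%:R * B i b).

Local Notation D := second_kind_map.

Lemma second_kind_mapE X x k :
  D X x 0 k = \sum_i 'D_(delta_mx 0 i) X x 0 ord_max * B i k.
Proof.
rewrite summxE; apply: eq_bigr => i _; rewrite mxE (bigD1 ord_max) //= big1.
  by rewrite mxE eqxx mul1r addr0.
by move=> a /negPf aN; rewrite mxE aN mul0r mulr0.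
Qed.

Lemma smooth_second_kind_map X : smooth X -> smooth (D X).
Proof.
move=> sX; apply: smooth_sum => i; apply: smooth_mulmx.
exact: smooth_derive.
Qed.

Lemma second_kind_map_linear (a : R) X Y : smooth X -> smooth Y ->
  D (fun x => a *: X x + Y x) = (fun x => a *: D X x + D Y x).
Proof.
move=> sX sY; apply/funext => x; apply/rowP => k.
rewrite !mxE !second_kind_mapE mulr_sumr -big_split; apply: eq_bigr => i _ /=.
have dX : derivable X x (delta_mx 0 i) by exact: smooth_derivable.
have dY : derivable Y x (delta_mx 0 i) by exact: smooth_derivable.
have h := is_deriveD (is_deriveZ a (derivableP dX)) (derivableP dY).
have E : 'D_(delta_mx 0 i) (fun x => a *: X x + Y x) x =
    a *: 'D_(delta_mx 0 i) X x + 'D_(delta_mx 0 i) Y x.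
  by have /@derive_val := h.
by rewrite E !mxE mulrDl mulrA.
Qed.

(** Where [B i b] is nonzero, both indices have weight [rho]: differentiating along [i] lowers the
    weight by [rho], and moving the last component to position b raises it by [r ord_max - rho]. *)
Lemma weight_second_kind_map (k l : int) X :
  l = (r ord_max)%:Z - 2 * rho%:Z ->
  weight_space R r k X -> weight_space R r (k + l) (D X).
Proof.
move=> lE wX; apply: weight_space_sum => i.
apply: (weight_space_mulmx (weight_space_derive i wX)) => a b.
rewrite mxE; have [->|_] := eqVneq a ord_max; last by rewrite mul0r eqxx.
rewrite mul1r => Bib; have ri := B_supp Bib.
by rewrite B_sym in Bib; have rb := B_supp Bib; lia.
Qed.

(** The map is a differential operator with constant coefficients, so Schwarz's theorem lets it
    commute with partial derivatives. *)
Lemma derive_second_kind_map X x m : smooth X ->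
  'D_(delta_mx 0 m) (D X) x = D ('D_(delta_mx 0 m) X) x.
Proof.
move=> sX; apply/rowP => k.
have dDX : derivable (D X) x (delta_mx 0 m).
  by apply: smooth_derivable; exact: smooth_second_kind_map.
rewrite -(derive_coord k dDX) second_kind_mapE.
pose c i (y : 'rV[R]_d.+1) : R := 'D_(delta_mx 0 i) X y 0 ord_max.
have E : (fun y => D X y 0 k) = \sum_i (B i k \*: c i).
  apply/funext => y; rewrite fct_sumE second_kind_mapE.
  by apply: eq_bigr => i _; rewrite mulrC.
have dc i : is_derive x (delta_mx 0 m) (c i)
    ('D_(delta_mx 0 m) ('D_(delta_mx 0 i) X) x 0 ord_max).
  have dX : derivable ('D_(delta_mx 0 i) X) x (delta_mx 0 m).
    by apply: smooth_derivable; exact: smooth_derive.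
  have h := derivableP (derivable_coord ord_max dX).
  by rewrite (derive_coord ord_max dX) in h.
have h := is_derive_sum (fun i => is_deriveZ (B i k) (dc i)).
rewrite E; have /@derive_val -> := h.
by apply: eq_bigr => i _; rewrite smooth_derive_comm// mulrC.
Qed.

Lemma second_kind_map_lie X Y : flag_field r X -> flag_field r Y ->
  D (lie X Y) = (fun x => lie (D X) Y x + lie X (D Y) x).
Proof.
move=> [sX fX] [sY fY]; apply/funext => x; apply/rowP => k.
have sDX := smooth_second_kind_map sX; have sDY := smooth_second_kind_map sY.
(* If [B i k] is nonzero then [r i = rho]. For m = N the factor d_N V^N vanishes; for any other [m],
   [r m <= rho = r i] makes d_i U^m vanish. *)
have fl (U V : vfield R d.+1) i m :
    (forall i j x, (r j <= r i)%N -> 'D_(delta_mx 0 i) U x 0 j = 0) ->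
    (forall i j x, (r j <= r i)%N -> 'D_(delta_mx 0 i) V x 0 j = 0) ->
    'D_(delta_mx 0 m) V x 0 ord_max * 'D_(delta_mx 0 i) U x 0 m * B i k = 0.
  move=> fU fV; have [->|/B_supp ri] := eqVneq (B i k) 0.
    by rewrite mulr0.
  have [->|/rho_max rm] := eqVneq m ord_max; first by rewrite fV ?mul0r.
  by rewrite fU ?ri// mulr0 mul0r.
rewrite mxE.
have -> : D (lie X Y) x 0 k = \sum_i (\sum_m
   (X x 0 m * 'D_(delta_mx 0 i) ('D_(delta_mx 0 m) Y) x 0 ord_max +
    'D_(delta_mx 0 m) Y x 0 ord_max * 'D_(delta_mx 0 i) X x 0 m -
    (Y x 0 m * 'D_(delta_mx 0 i) ('D_(delta_mx 0 m) X) x 0 ord_max +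
    'D_(delta_mx 0 m) X x 0 ord_max * 'D_(delta_mx 0 i) Y x 0 m))) * B i k.
  rewrite second_kind_mapE; apply: eq_bigr => i _.
  by rewrite derive_lie_coord.
have -> : lie (D X) Y x 0 k = \sum_m
   ((\sum_i 'D_(delta_mx 0 i) X x 0 ord_max * B i m) *
     'D_(delta_mx 0 m) Y x 0 k -
    Y x 0 m * \sum_i
      'D_(delta_mx 0 i) ('D_(delta_mx 0 m) X) x 0 ord_max * B i k).
  rewrite lie_coordE//; apply: eq_bigr => m _.
  by rewrite derive_second_kind_map// !second_kind_mapE.
have -> : lie X (D Y) x 0 k = \sum_m
   (X x 0 m * (\sum_i
      'D_(delta_mx 0 i) ('D_(delta_mx 0 m) Y) x 0 ord_max * B i k) -
    (\sum_i 'D_(delta_mx 0 i) Y x 0 ord_max * B i m) *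
     'D_(delta_mx 0 m) X x 0 k).
  rewrite lie_coordE//; apply: eq_bigr => m _.
  by rewrite derive_second_kind_map// !second_kind_mapE.
apply: (second_kind_identity (fun m => X x 0 m) (fun m => Y x 0 m)
  (fun i m => 'D_(delta_mx 0 i) ('D_(delta_mx 0 m) X) x 0 ord_max)
  (fun i m => 'D_(delta_mx 0 i) ('D_(delta_mx 0 m) Y) x 0 ord_max)
  B_sym (fun i m => fl X Y i m fX fY) (fun i m => fl Y X i m fY fX)).
(* For k different from N, a nonzero [B i m] gives [r m = rho >= r k], so d_m X^k and d_m Y^k
   vanish. *)
have [|/rho_max rk] := eqVneq k ord_max; [by left|right=> i m].
have [->|] := eqVneq (B i m) 0; first by rewrite !mul0r.
rewrite B_sym => /B_supp rm; have mk : (r k <= r m)%N by rewrite rm.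
by rewrite (fX m k x mk) (fY m k x mk) !mulr0.
Qed.

End SecondKindMap.

(** * Uniqueness *)

Section LieExamples.
Context {R : realType} {d : nat}.
Implicit Types (X Y : vfield R d) (x : 'rV[R]_d).

Lemma derive_partial_vf i v x : 'D_v (partial_vf R i) x = 0 :> 'rV[R]_d.
Proof. exact: derive_cst. Qed.

Lemma derive_linear_vf i j v x :
  'D_v (linear_vf R i j) x = linear_vf R i j v :> 'rV[R]_d.
Proof.
rewrite linear_vf_mulmx.
by have /@derive_val := is_derive_mulmx_id (delta_mx i j : 'M[R]_d) x v.
Qed.

Lemma lie_partial_vf i Y : lie (partial_vf R i) Y = 'D_(delta_mx 0 i) Y.
Proof. by apply/funext => x; rewrite /lie derive_partial_vf subr0. Qed.

Lemma lie0_vf Y : lie (fun=> 0) Y = (fun=> 0).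
Proof.
apply/funext => x; rewrite /lie derive0 sub0r.
have -> : 'D_(Y x) (fun=> 0 : 'rV[R]_d) x = 0 by exact: derive_cst.
by rewrite oppr0.
Qed.

Lemma lie_linear_vf i j Y x : smooth Y -> lie (linear_vf R i j) Y x =
  x 0 i *: 'D_(delta_mx 0 j) Y x - Y x 0 i *: delta_mx 0 j.
Proof.
move=> sY; rewrite /lie derive_linear_vf; congr (_ - _).
apply/rowP => k; rewrite smooth_deriveE// (bigD1 j) //= big1 => [|m mj].
  by rewrite !mxE !eqxx mulr1 addr0.
by rewrite !mxE (negPf mj) andbF mulr0 mul0r.
Qed.

End LieExamples.

Section WeightedDerivation.
Context {R : realType} {d : nat}.
Variables (r : 'I_d.+1 -> nat) (l : int) (D : vfield R d.+1 -> vfield R d.+1).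
Hypothesis r_max : forall i, (r i <= r ord_max)%N.
Hypothesis D_der : weighted_derivation r l D.
Implicit Types (X Y : vfield R d.+1).

Let zero_in : negative_part R r (fun=> 0).
Proof. exact: (negative_weight_space r_max (ltrN10 _) (weight_space0 r _)). Qed.

Lemma derivation0 : D (fun=> 0) = (fun=> 0).
Proof.
(* With coefficient -1, linearity reads D 0 = - D 0 + D 0. *)
have [Dlin _ _] := D_der; have := Dlin (-1) _ _ zero_in zero_in.
have -> : (fun x : 'rV[R]_d.+1 => -1 *: 0 + 0) = (fun=> 0 : 'rV[R]_d.+1).
  by apply/funext => x; rewrite scaler0 addr0.
by move=> ->; apply/funext => x; rewrite scaleN1r addNr.
Qed.

Lemma derivationZ (a : R) X : negative_part R r X ->
  D (fun x => a *: X x) = (fun x => a *: D X x).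
Proof.
have [Dlin _ _] := D_der => mX; have := Dlin a _ _ mX zero_in.
rewrite derivation0.
have -> : (fun x => a *: X x + 0) = (fun x => a *: X x).
  by apply/funext => x; rewrite addr0.
by move=> ->; apply/funext => x; rewrite addr0.
Qed.

Lemma derivationD X Y : negative_part R r X -> negative_part R r Y ->
  D (fun x => X x + Y x) = (fun x => D X x + D Y x).
Proof.
have [Dlin _ _] := D_der => mX mY; have := Dlin 1 _ _ mX mY.
have -> : (fun x => 1 *: X x + Y x) = (fun x => X x + Y x).
  by apply/funext => x; rewrite scale1r.
by move=> ->; apply/funext => x; rewrite scale1r.
Qed.

(** The bracket with d_i is the partial derivative, so a derivation killing d_i commutes with it. *)
Lemma derivation_derive i X : negative_part R r (partial_vf R i) ->
  D (partial_vf R i) = (fun=> 0) -> negative_part R r X ->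
  'D_(delta_mx 0 i) (D X) = D ('D_(delta_mx 0 i) X).
Proof.
have [_ _ Dlie] := D_der => mi Di mX; have := Dlie _ _ mi mX.
rewrite Di lie0_vf !lie_partial_vf => ->.
by apply/funext => x; rewrite add0r.
Qed.

End WeightedDerivation.

Section Uniqueness.
Context {R : realType} {d : nat}.
Variables (r : 'I_d.+1 -> nat) (l : int).
Variables D1 D2 : vfield R d.+1 -> vfield R d.+1.
Hypothesis r_max : forall i, (r i <= r ord_max)%N.
Hypothesis r_gt0 : forall i, (0 < r i)%N.
Hypothesis l_ge0 : 0 <= l.
Hypothesis D1_der : weighted_derivation r l D1.
Hypothesis D2_der : weighted_derivation r l D2.
Hypothesis D1_partial : forall i, D1 (partial_vf R i) = (fun=> 0).
Hypothesis D2_partial : forall i, D2 (partial_vf R i) = (fun=> 0).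
Hypothesis D12_linear : forall i j, (r i < r j)%N ->
  D1 (linear_vf R i j) = D2 (linear_vf R i j).
Implicit Types (X Y : vfield R d.+1) (x : 'rV[R]_d.+1) (k : int).

Let partial_in i : negative_part R r (partial_vf R i).
Proof.
apply: (negative_weight_space r_max _ (weight_space_partial r i)).
by have := r_gt0 i; lia.
Qed.

(** For X = f d_j the bracket is (x^a d_j f - f d_j x^a) d_j: here d_j f = 0 because the weight is
    negative, and d_j x^a = 0 because [a] differs from [j]. *)
Lemma lie_linear_vf_eq0 k X a j : k < 0 -> weight_space R r k X ->
  (forall m x, m != j -> X x 0 m = 0) -> a != j ->
  lie (linear_vf R a j) X = (fun=> 0).
Proof.
move=> k0 wX Xj aj; have sX := weight_space_smooth wX.
apply/funext => x; rewrite lie_linear_vf// Xj// scale0r subr0.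
suff -> : 'D_(delta_mx 0 j) X x = 0 by rewrite scaler0.
apply/rowP => m; rewrite mxE; have [->|mj] := eqVneq m j.
  exact: (negative_weight_derive0 x wX).
have dX : derivable X x (delta_mx 0 j) by exact: smooth_derivable.
rewrite -(derive_coord m dX).
have -> : (fun y => X y 0 m) = (fun=> 0).
  by apply/funext => y; exact: Xj.
exact: derive_cst.
Qed.

Lemma derivation_unique_component k X j : k < 0 -> weight_space R r k X ->
  (forall m x, m != j -> X x 0 m = 0) ->
  (forall i, D1 ('D_(delta_mx 0 i) X) = D2 ('D_(delta_mx 0 i) X)) ->
  D1 X = D2 X.
Proof.
move=> k0 wX Xj DX12; have mX := negative_weight_space r_max k0 wX.
have sX := weight_space_smooth wX.
have [D1lin D1w D1lie] := D1_der; have [D2lin D2w D2lie] := D2_der.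
(* In the first case the derivatives of X^j have negative weight, so [X] is a constant multiple of
   d_j and both derivations kill it. *)
have [kj|kj] := leP (k + (r j)%:Z) 0.
  have Xc x : X x 0 j = X 0 0 j.
    apply: smooth_coord_cst => // i y.
    apply: (weight_space_coord0 (weight_space_derive i wX)).
    by have := r_gt0 i; lia.
  have -> : X = (fun x => X 0 0 j *: partial_vf R j x).
    apply/funext => x; apply/rowP => m; rewrite !mxE eqxx /=.
    have [->|mj] := eqVneq m j; first by rewrite mulr1.
    by rewrite Xj// mulr0.
  rewrite (derivationZ r_max D1_der)// (derivationZ r_max D2_der)//.
  by rewrite D1_partial D2_partial.
have w1 := D1w _ _ k0 wX; have w2 := D2w _ _ k0 wX.
have s1 := weight_space_smooth w1; have s2 := weight_space_smooth w2.
have dE i x a : 'D_(delta_mx 0 i) (D1 X) x 0 a = 'D_(delta_mx 0 i) (D2 X) x 0 a.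
  have h1 := derivation_derive D1_der (partial_in i) (D1_partial i) mX.
  have h2 := derivation_derive D2_der (partial_in i) (D2_partial i) mX.
  have h := etrans h1 (etrans (DX12 i) (esym h2)).
  exact: (congr1 (fun g : vfield R d.+1 => g x 0 a) h).
apply/funext => x; apply/rowP => a.
(* Component [a] of both images has weight [k + l + r a]. Their partial derivatives agree, so
   Euler's identity equates them unless this weight is 0. *)
have [ka|ka] := eqVneq (k + l + (r a)%:Z) 0; last first.
  have /weight_spaceP[_ e1] := w1; have /weight_spaceP[_ e2] := w2.
  have h : (k + l + (r a)%:Z)%:~R * D1 X x 0 a =
           (k + l + (r a)%:Z)%:~R * D2 X x 0 a.
    rewrite -e1 -e2 (smooth_deriveE _ _ _ s1) (smooth_deriveE _ _ _ s2).
    by apply: eq_bigr => i _; congr (_ * _); exact: dE.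
  by apply: (mulfI _ h); rewrite intr_eq0.
(* Here [r a = - k - l <= - k < r j], so x^a d_j has negative weight and can serve as a test
   field. *)
have raj : (r a < r j)%N by lia.
have aj : a != j by apply: contraTneq raj => ->; rewrite ltnn.
have mL : negative_part R r (linear_vf R a j).
  apply: (negative_weight_space r_max _ (weight_space_linear_vf r a j)).
  by lia.
have L0 := lie_linear_vf_eq0 k0 wX Xj aj.
have h1 : (fun y => lie (D2 (linear_vf R a j)) X y +
    lie (linear_vf R a j) (D1 X) y) = (fun=> 0).
  rewrite -(D12_linear raj) -(D1lie _ _ mL mX) L0.
  exact: derivation0 r_max D1_der.
have h2 : (fun y => lie (D2 (linear_vf R a j)) X y +
    lie (linear_vf R a j) (D2 X) y) = (fun=> 0).
  by rewrite -(D2lie _ _ mL mX) L0; exact: derivation0 r_max D2_der.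
(* Component [j] of the bracket with the test field isolates Y^a: the derivative terms agree for
   [D1 X] and [D2 X]. *)
have f (Y : vfield R d.+1) : smooth Y -> lie (linear_vf R a j) Y x 0 j =
    x 0 a * 'D_(delta_mx 0 j) Y x 0 j - Y x 0 a.
  by move=> sY; rewrite lie_linear_vf// !mxE !eqxx mulr1.
have f2 := f _ s2; rewrite -(dE j x j) in f2.
have addE (u v : 'rV[R]_d.+1) : (u + v) 0 j = u 0 j + v 0 j by rewrite mxE.
have e := congr1 (fun Z : vfield R d.+1 => Z x 0 j) (etrans h1 (esym h2)).
move: (etrans (esym (addE _ _)) (etrans e (addE _ _))) => /addrI {}e.
have := etrans (esym (f _ s1)) (etrans e f2).
by move=> /addrI /oppr_inj.
Qed.

(** Membership in m is carried along because the derivations are additive only there. *)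
Let agree X := negative_part R r X /\ D1 X = D2 X.

Let agree0 : agree (fun=> 0).
Proof.
split; last by rewrite (derivation0 r_max D1_der) (derivation0 r_max D2_der).
exact: (negative_weight_space r_max (ltrN10 _) (weight_space0 r _)).
Qed.

Let agreeD X Y : agree X -> agree Y -> agree (fun x => X x + Y x).
Proof.
move=> [mX DX] [mY DY]; split; last first.
  by rewrite (derivationD D1_der)// (derivationD D2_der)// DX DY.
have := negative_part_linear 1 mX mY; congr negative_part.
by apply/funext => x; rewrite scale1r.
Qed.

Lemma derivation_unique_weight k X : k < 0 -> weight_space R r k X ->
  D1 X = D2 X.
Proof.
move=> k0 wX.
(* Induction on a bound [s] for [k + r ord_max]: at 0 all components have negative weight and [X]
   vanishes, while each partial derivative lowers the weight by at least 1. *)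
have [s] : exists s : nat, (r ord_max)%:Z < s%:Z - k.
  by exists (r ord_max); lia.
elim: s => [|s IHs] in k X k0 wX *; move=> ks.
  suff -> : X = (fun=> 0) by have [] := agree0.
  apply/funext => x; apply/rowP => j; rewrite mxE.
  by apply: (weight_space_coord0 wX); have := r_max j; lia.
(* [F j] is the single-component field X^j d_j, of the same weight as [X]. *)
pose F j : vfield R d.+1 := fun x => X x *m delta_mx j j.
have wF j : weight_space R r k (F j).
  apply: (weight_space_mulmx wX) => a b; rewrite mxE.
  have [->|_] := eqVneq a j; last by rewrite eqxx.
  by have [->|_] := eqVneq b j; last by rewrite eqxx.
have aF j : agree (F j).
  split; first exact: negative_weight_space k0 (wF j).
  apply: (derivation_unique_component (j := j) k0 (wF j)) => [m x mj|i].
    rewrite mxE big1 // => a _.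
    by rewrite mxE (negPf mj) andbF mulr0.
  apply: IHs (weight_space_derive i (wF j)) _; have := r_gt0 i; lia.
have -> : X = (fun x => \sum_(j <- enum 'I_d.+1) F j x).
  apply/funext => x; rewrite big_enum /= -[LHS]mulmx1 mx1_sum_delta.
  by rewrite mulmx_sumr.
suff : agree (fun x => \sum_(j <- enum 'I_d.+1) F j x) by case.
elim: (enum _) => [|j t IHt].
  suff -> : (fun x => \sum_(j <- [::]) F j x) = (fun=> 0) by [].
  by apply/funext => x; rewrite big_nil.
suff -> : (fun x => \sum_(i <- j :: t) F i x) =
    (fun x => F j x + \sum_(i <- t) F i x) by exact: agreeD.
by apply/funext => x; rewrite big_cons.
Qed.

Lemma derivation_unique X : negative_part R r X -> D1 X = D2 X.
Proof.
move=> mX; suff : agree X by case.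
apply: negative_part_ind mX => // k Y k0 wY.
by split; [exact: negative_weight_space k0 wY|
  exact: derivation_unique_weight k0 wY].
Qed.

End Uniqueness.

(** * Extension of the matrix by zero, and the theorem *)

Section SymmetricMatrix.
Context {R : realType} {n : nat}.
Variables (r : 'I_n.+2 -> nat) (A : 'M[R]_n.+1).
Implicit Types (i j : 'I_n.+1) (a b : 'I_n.+2).

Lemma low_inj : injective (@low n).
Proof. by move=> i j /(congr1 val) ij; exact: val_inj. Qed.

Lemma lowP a : a != ord_max -> exists i, a = low i.
Proof.
move=> aN; have an : (a < n.+1)%N.
  by rewrite ltn_neqAle -ltnS ltn_ord andbT.
by exists (Ordinal an); exact: val_inj.
Qed.

(** This is [A] bordered by a zero last row and column; the indicators avoid inverting [low]. *)
Definition extend_mx : 'M[R]_n.+2 := \matrix_(a, b)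
  \sum_i \sum_j A i j * ((a == low i) && (b == low j))%:R.

Lemma extend_mx_sym : A^T = A -> forall a b, extend_mx a b = extend_mx b a.
Proof.
move=> A_sym a b; rewrite !mxE exchange_big /=.
apply: eq_bigr => i _; apply: eq_bigr => j _.
by rewrite -{1}A_sym mxE andbC.
Qed.

Lemma extend_mx_neq0 a b : extend_mx a b != 0 ->
  exists i j, [/\ A i j != 0, a = low i & b = low j].
Proof.
apply: contra_neqP => h; rewrite mxE big1 // => i _; rewrite big1 // => j _.
have [A0|A0] := eqVneq (A i j) 0; first by rewrite A0 mul0r.
have [ai|_] := eqVneq a (low i); last by rewrite mulr0.
have [bj|_] := eqVneq b (low j); last by rewrite mulr0.
by case: h; exists i, j.
Qed.

Lemma extend_mx_low i b :
  extend_mx (low i) b = \sum_j A i j * (b == low j)%:R.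
Proof.
rewrite mxE (bigD1 i) //= [X in _ + X]big1 => [|k ki].
  by rewrite addr0; apply: eq_bigr => j _; rewrite eqxx.
by rewrite big1 // => j _; rewrite (inj_eq low_inj) eq_sym (negPf ki) mulr0.
Qed.

End SymmetricMatrix.

Lemma second_kind_map_linear_vf {R : realType} {d : nat} (B : 'M[R]_d.+1)
    i j x k :
  second_kind_map B (linear_vf R i j) x 0 k = (j == ord_max)%:R * B i k.
Proof.
rewrite second_kind_mapE (bigD1 i) //= big1 => [|m mi].
  rewrite derive_linear_vf !mxE !eqxx /= addr0 mul1r [ord_max == j]eq_sym.
  by [].
by rewrite derive_linear_vf !mxE eqxx eq_sym (negPf mi) !mul0r.
Qed.

Theorem theorem2p1 (R : realType) (n : nat) (r : 'I_n.+2 -> nat) (l : int)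
    (A : 'M[R]_n.+1)
    (r_gt0 : forall i, (0 < r i)%N)
    (r_mono : forall i j : 'I_n.+2, (i <= j)%N -> (r i <= r j)%N)
    (lE : l = (r ord_max)%:Z - 2 * (r (low ord_max))%:Z)
    (l_ge0 : 0 <= l)
    (A_sym : A^T = A)
    (A_supp : forall i j : 'I_n.+1, A i j != 0 ->
       r (low i) = r (low ord_max) /\ r (low j) = r (low ord_max)) :
  exists D : vfield R n.+2 -> vfield R n.+2,
    [/\ second_kind_derivation r A l D,
        forall D' : vfield R n.+2 -> vfield R n.+2,
          second_kind_derivation r A l D' ->
          forall X, negative_part R r X -> D' X = D X &
        A != 0 ->
        ~ exists2 X, weight_space R r l X &
            forall Y, negative_part R r Y -> D Y = lie X Y].
Proof.
have r_max i : (r i <= r ord_max)%N by apply: r_mono; rewrite -ltnS.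
have low_max (i : 'I_n.+1) : (r (low i) <= r (low ord_max))%N.
  by apply: r_mono; rewrite /= -ltnS.
have rho_max j : j != ord_max -> (r j <= r (low ord_max))%N.
  by move=> /lowP[i ->].
(* From l >= 0, the last weight is at least twice the penultimate one, hence strictly larger; so x^i
   d_n lies in m for every i < n. *)
have low_lt i : (r (low i) < r ord_max)%N.
  by have := low_max i; have := r_gt0 (low ord_max); lia.
pose B := extend_mx A; have B_sym := extend_mx_sym A_sym.
have B_supp a b : B a b != 0 -> r a = r (low ord_max).
  by move=> /extend_mx_neq0[i [j [/A_supp[ri _] -> _]]].
pose D : vfield R n.+2 -> vfield R n.+2 := second_kind_map B.
have D_der : weighted_derivation r l D.
  split=> [a X Y|p X _ wX|X Y].
  - move=> /negative_part_flag[sX _] /negative_part_flag[sY _].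
    exact: second_kind_map_linear.
  - exact: (weight_second_kind_map B_sym B_supp lE wX).
  - move=> /negative_part_flag fX /negative_part_flag fY.
    exact: (second_kind_map_lie B_sym B_supp rho_max fX fY).
have D_partial i : D (partial_vf R i) = (fun=> 0).
  apply/funext => x; apply/rowP => k.
  rewrite second_kind_mapE mxE big1// => m _.
  by rewrite derive_partial_vf mxE mul0r.
have D_linear (i : 'I_n.+1) j : D (linear_vf R (low i) j) =
    (fun x => (j == ord_max)%:R *:
       \sum_(k < n.+1) A i k *: partial_vf R (low k) x).
  apply/funext => x; apply/rowP => k; rewrite second_kind_map_linear_vf.
  rewrite [RHS]mxE summxE extend_mx_low; congr (_ * _).
  by apply: eq_bigr => m _; rewrite !mxE eqxx.
exists D; split=> [//|D' [D'_der D'_partial D'_linear] X mX|A0].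
  apply: (derivation_unique r_max r_gt0 l_ge0 D'_der D_der) => // i j ij.
  have /lowP[a ia] : i != ord_max.
    by apply: contraTneq ij => ->; rewrite -leqNgt.
  by rewrite ia in ij *; rewrite D'_linear// D_linear.
move=> [X wX DX].
have mE i : negative_part R r (partial_vf R i).
  apply: (negative_weight_space r_max _ (weight_space_partial r i)).
  by have := r_gt0 i; lia.
have sX := weight_space_smooth wX.
(* The bracket of [X] with d_i is minus the partial derivative of [X], and [D] kills d_i. *)
have dX i x k : 'D_(delta_mx 0 i) X x 0 k = 0.
  have := congr1 (fun Y : vfield R n.+2 => Y x 0 k) (DX _ (mE i)).
  rewrite D_partial /lie derive_partial_vf sub0r !mxE => /eqP.
  by rewrite eq_sym oppr_eq0 => /eqP.
(* With all derivatives zero, Euler's identity leaves (l + r_a) X^a = 0, where l + r_a > 0. *)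
have X0 : X = (fun=> 0).
  apply/funext => x; apply/rowP => a; rewrite mxE.
  have /weight_spaceP[_ /(_ x a)] := wX.
  rewrite smooth_deriveE// big1 => [/esym/eqP|i _]; last by rewrite dX mulr0.
  rewrite mulf_eq0 intr_eq0 => /orP[|/eqP//].
  by have := r_gt0 a; lia.
(* The value of [D] on x^i d_n is row [i] of [A], so D = 0 on m forces A = 0. *)
case/eqP: A0; apply/matrixP => i k.
have mL : negative_part R r (linear_vf R (low i) ord_max).
  apply: (negative_weight_space r_max _ (weight_space_linear_vf r _ _)).
  by have := low_lt i; lia.
have := congr1 (fun Y : vfield R n.+2 => Y 0 0 (low k)) (DX _ mL).
rewrite X0 lie0_vf /= second_kind_map_linear_vf eqxx mul1r extend_mx_low.
rewrite (bigD1 k) //= big1 => [|m mk].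
  by rewrite eqxx mulr1 addr0 => ->; rewrite !mxE.
by rewrite (inj_eq low_inj) eq_sym (negPf mk) mulr0.
Qed.
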